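(* Let $n\ge1$, let $J\in\mathbb{C}^{n\times n}$ satisfy $J=J^*=J^{-1}$ and have inertia $(n-q,q)$ (that is, $n-q$ eigenvalues equal to $1$ and $q$ eigenvalues equal to $-1$, counted with multiplicity). Let $A\in\mathbb{C}^{n\times n}$ satisfy $A^*J=JA$ and $\sigma(A)\subset\{z\in\mathbb{C}:|z|\le 1\}$. Then, for every integer $k\ge1$, $$\|A^k\|_2\le\left(1+\frac1k\right)^k\min\{k+1,\,\nu_J(A)\}\,\mathcal{K}(A).$$ Consequently, for every integer $k\ge0$, $$\|A^k\|_2\le e\min\{k+1,\,\nu_J(A)\}\,\mathcal{K}(A).$$
   Context: $\|\cdot\|_2$ is the spectral norm (operator norm induced by the Euclidean norm) and $\sigma(A)$ is the spectrum of $A$. For $A\in\mathbb{C}^{n\times n}$ with $\sigma(A)$ in the closed unit disk, the Kreiss constant is $\mathcal{K}(A):=\sup_{|z|>1}(|z|-1)\|(zI-A)^{-1}\|_2$; it may equal $+\infty$, and inequalities are understood in the extended sense. Let $d(A)$ be the degree of the minimal polynomial of $A$. With $q$ the number of negative eigenvalues of $J$, set $\nu_J(A):=\min\{d(A),\,2q+1,\,2(n-q)+1\}$. *)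

(* Defs.v *)
From mathcomp Require Export all_boot all_order all_algebra.
From mathcomp Require Export all_classical all_reals all_analysis.
From mathcomp Require Export complex.

Set Implicit Arguments.
Unset Strict Implicit.
Unset Printing Implicit Defensive.

Import Order.TTheory GRing.Theory Num.Theory.

Local Open Scope classical_set_scope.
Local Open Scope ring_scope.
Local Open Scope complex_scope.
Local Open Scope sesquilinear_scope.

(* Real-valued modulus: the norm `|z| of R[i] has its values in R[i]. *)
Notation cmod := Normc.normc.

Definition enorm2 (R : realType) n (x : 'cV[R[i]]_n) : R :=
  Num.sqrt (\sum_(i < n) cmod (x i 0) ^+ 2).

(* The set is nonempty and bounded above, so the supremum in R is genuine. *)
Definition specnorm (R : realType) n (A : 'M[R[i]]_n) : R :=
  sup [set enorm2 (A *m x) | x in [set x : 'cV[R[i]]_n | enorm2 x <= 1]].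

Definition kreiss (R : realType) n (A : 'M[R[i]]_n) : \bar R :=
  ereal_sup [set ((cmod z - 1) * specnorm (invmx (z%:M - A)))%:E
            | z in [set z : R[i] | 1 < cmod z]].

(* The roots of the characteristic polynomial, each listed as many times as
   its algebraic multiplicity, in an unspecified order. *)
Definition eigenvalues (R : realType) n (A : 'M[R[i]]_n) : seq R[i] :=
  sval (closed_field_poly_normal (char_poly A)).

(* The order of R[i] is partial: 0 < z means that z is real and positive. *)
Definition num_pos_eig (R : realType) n (J : 'M[R[i]]_n) : nat :=
  count (fun z => 0 < z) (eigenvalues J).

Definition num_neg_eig (R : realType) n (J : 'M[R[i]]_n) : nat :=
  count (fun z => z < 0) (eigenvalues J).

Definition inertia (R : realType) n (J : 'M[R[i]]_n) : nat * nat :=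
  (num_pos_eig J, num_neg_eig J).

Definition nuJ (R : realType) n (J A : 'M[R[i]]_n.+1) : nat :=
  let q := num_neg_eig J in
  minn (degree_mxminpoly A) (minn (2 * q + 1) (2 * (n.+1 - q) + 1)).

(* Main.v *)
(** Put [B = A / r] with [r = 1 + 1/k]; the Kreiss constant bounds
    the resolvent of [B] on the unit circle.  The Hankel matrix
    [G = (y^* B^(i+l) x)_(i,l)] is a compression of multiplication by
    [y^* (z - B)^-1 x], so its operator norm is at most this bound.  Pairing [G]
    with the flip [F = (i + j == k)_(i,j)] gives [\tr (G F) = (k+1) y^* B^k x],
    whence [(k+1) |y^* B^k x| <= rank G * norm G], and the rank of [G] is at most
    the degree of the minimal polynomial.
    If [A] is [J]-selfadjoint and [y = J x], then [G = V^* J V] is Hermitian and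
    is nonnegative on a subspace of codimension [rank (1 - J) = q], so that the
    trace norm of [G] is at most [\tr G + 2 q * norm G].  Moreover [\tr G] is the
    odd part of the symbol at [z = 1], so it obeys the same bound, which yields the
    factor [2 q + 1].  As [J B^k] is Hermitian, its quadratic form controls its
    norm, and [- J] gives the other inertia bound.
    All this is done on the [N]-th roots of unity, where
    [(z - B)^-1 (1 - B^N)] is a polynomial in [B] and [z], letting [N] grow. *)

Require Import Defs.
From mathcomp Require Import cyclic separable cyclotomic ring lra zify.

Import Order.TTheory GRing.Theory Num.Theory.
Local Open Scope ring_scope.
Local Open Scope sesquilinear_scope.
Set Implicit Arguments.
Unset Strict Implicit.
Unset Printing Implicit Defensive.

(** * Hankel forms and the finite Fourier transform on roots of unity *)

Section Hankel.
Variable C : numClosedFieldType.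

(** In characteristic zero ['X^N - 1] is separable, so it has [N] distinct roots, enough to force a
    primitive one among them. *)
Lemma prim_root_exists (N : nat) : (0 < N)%N -> exists w : C, N.-primitive_root w.
Proof.
move=> N_gt0; have [r Dp] := closed_field_poly_normal ('X^N - 1 : {poly C}).
rewrite (monicP _) ?monicXnsubC // scale1r in Dp.
have rn1 : all N.-unity_root r by apply/allP=> z; rewrite -root_prod_XsubC -Dp.
have sz_r : (N < (size r).+1)%N by rewrite -(size_prod_XsubC r id) -Dp size_XnsubC.
have [|z _] := hasP (has_prim_root N_gt0 rn1 _ sz_r); last by exists z.
by rewrite -separable_prod_XsubC -Dp separable_Xn_sub_1 // pnatr_eq0 -lt0n.
Qed.

(** A geometric sum of ratio [w ^+ (N + i - l)], which is 1 only for [i = l]. Adding [N] keeps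
    truncated subtraction from cutting off [i - l]; modulo [N] it changes nothing. *)
Lemma prim_root_ortho (N : nat) (w : C) (i l : nat) :
  N.-primitive_root w -> (i < N)%N -> (l < N)%N ->
  \sum_(j < N) w ^+ j ^+ (N + i - l) = (N%:R *+ (i == l)).
Proof.
move=> pw iN lN; have [<-|nil] := eqVneq i l.
  rewrite addnK (eq_bigr (fun=> 1)) ?sumr_const ?card_ord // => j _.
  by rewrite exprAC (prim_expr_order pw) expr1n.
have zn1 : w ^+ (N + i - l) != 1.
  rewrite -(prim_order_dvd pw); apply: contra nil.
  rewrite /dvdn; have [il|li] := ltnP i l.
    rewrite modn_small; lia.
  by rewrite -addnBA // modnDl modn_small; lia.
have : (w ^+ (N + i - l) - 1) * \sum_(j < N) w ^+ j ^+ (N + i - l) = 0.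
  under eq_bigr do rewrite exprAC.
  by rewrite -subrX1 exprAC (prim_expr_order pw) expr1n subrr.
by move/eqP; rewrite mulf_eq0 subr_eq0 (negPf zn1) => /eqP.
Qed.

Lemma norm_unity_root (N : nat) (z : C) : (0 < N)%N -> z ^+ N = 1 -> `|z| = 1.
Proof.
move=> N0 zN; apply/eqP; rewrite -(@pexpr_eq1 _ _ N) //.
by rewrite -normrX zN normr1.
Qed.

Lemma conj_unity_root (N l : nat) (z : C) :
  (l <= N)%N -> (0 < N)%N -> z ^+ N = 1 -> (z ^+ l)^* = z ^+ (N - l).
Proof.
move=> lN N0 zN; have z1 := norm_unity_root N0 zN.
have zl : `|z ^+ l| ^+ 2 = 1 by rewrite normrX z1 !expr1n.
have zl0 : z ^+ l != 0 by rewrite -normr_eq0 normrX z1 expr1n oner_neq0.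
by apply: (mulfI zl0); rewrite -normCK zl -exprD subnKC.
Qed.

Definition sqn n (x : 'cV[C]_n) : C := \sum_i `|x i 0| ^+ 2.

Lemma sqn_ge0 n (x : 'cV[C]_n) : 0 <= sqn x.
Proof. by apply: sumr_ge0 => i _; rewrite exprn_ge0. Qed.

(** Expanding the square gives a double sum in which orthogonality keeps only the diagonal; [P <= N]
    keeps distinct frequencies distinct modulo [N]. *)
Lemma parseval (N P : nat) (w : C) (a : 'I_P -> C) :
  N.-primitive_root w -> (P <= N)%N ->
  \sum_(j < N) `|\sum_(i < P) a i * w ^+ j ^+ i| ^+ 2 =
  N%:R * \sum_(i < P) `|a i| ^+ 2.
Proof.
move=> pw PN; have N0 := prim_order_gt0 pw.
have wN j : (w ^+ j) ^+ N = 1 by rewrite exprAC (prim_expr_order pw) expr1n.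
transitivity (\sum_(j < N) \sum_(i < P) \sum_(l < P)
    a i * (a l)^* * w ^+ j ^+ (N + i - l)).
  apply: eq_bigr => j _; rewrite normCK rmorph_sum big_distrlr /=.
  apply: eq_bigr => i _; apply: eq_bigr => l _.
  have lN : (l <= N)%N by rewrite ltnW // (leq_trans (ltn_ord l)).
  by rewrite rmorphM /= (@conj_unity_root N) ?wN // mulrACA -exprD addnC -addnBAC.
rewrite exchange_big mulr_sumr; apply: eq_bigr => i _.
rewrite exchange_big (bigD1 i) //= [X in _ + X]big1 ?addr0 => [|l nli].
    by rewrite -mulr_sumr prim_root_ortho ?(leq_trans (ltn_ord i)) // eqxx -normCK mulrC.
rewrite -mulr_sumr prim_root_ortho ?(leq_trans (ltn_ord _)) //.
by rewrite eq_sym (negPf (nli : (l : nat) != i)) mulr0n mulr0.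
Qed.

(* For an [N]-th root of unity [z], [z ^+ (N - l.+1)] is [z^-(l+1)]: the sum is the
   symbol of the Hankel form. *)
Lemma hankel_bound (N P : nat) (c : nat -> C) (M : C) (u v : 'cV[C]_P) :
  (0 < N)%N -> (P.*2 <= N)%N ->
  (forall z, z ^+ N = 1 -> `|\sum_(l < N) z ^+ (N - l.+1) * c l| <= M) ->
  `|\sum_(i < P) \sum_(l < P) (u i 0)^* * c (i + l)%N * v l 0|
    <= M * ((sqn u + sqn v) / 2).
Proof.
move=> N0 PN hM; have [w pw] := prim_root_exists N0.
have PN' : (P <= N)%N by lia.
have wN j : (w ^+ j) ^+ N = 1 by rewrite exprAC (prim_expr_order pw) expr1n.
pose g j := \sum_(l < N) w ^+ j ^+ (N - l.+1) * c l.
(* Fourier inversion: the coefficients are recovered from the values [g j] of the symbol. *)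
have cE t : (t < N)%N -> c t = N%:R^-1 * \sum_(j < N) w ^+ j ^+ t.+1 * g j.
  move=> tN; under eq_bigr do rewrite mulr_sumr.
  rewrite exchange_big (bigD1 (Ordinal tN)) //= [X in _ + X]big1 => [|l nl].
    under eq_bigr do rewrite mulrA -exprD subnKC // wN mul1r.
    by rewrite sumr_const card_ord addr0 -[c t *+ N]mulr_natl mulKf // pnatr_eq0 -lt0n.
  under eq_bigr => j _ do
    rewrite mulrA -exprD addnBA // addnC addnS subSS.
  rewrite -mulr_suml prim_root_ortho //.
  by rewrite eq_sym (negPf (nl : (l : nat) != t)) mul0r.
pose U j := \sum_(i < P) (u i 0)^* * w ^+ j ^+ i.
pose V j := \sum_(i < P) v i 0 * w ^+ j ^+ i.
(* The character at [i + l] factors, so the form is an average of the symbol against [U j * V j].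
   Inversion applies because [i + l < P.*2 <= N]. *)
have -> : \sum_(i < P) \sum_(l < P) (u i 0)^* * c (i + l)%N * v l 0 =
    N%:R^-1 * \sum_(j < N) w ^+ j * g j * (U j * V j).
  transitivity (\sum_(i < P) \sum_(l < P) \sum_(j < N)
     N%:R^-1 * (w ^+ j * g j * (((u i 0)^* * w ^+ j ^+ i) * (v l 0 * w ^+ j ^+ l)))).
    apply: eq_bigr => i _; apply: eq_bigr => l _.
    rewrite cE; last by rewrite (leq_trans _ PN) // -addnn -addSn leq_add // ltnW.
    rewrite mulr_sumr mulr_sumr mulr_suml; apply: eq_bigr => j _.
    by rewrite exprS exprD; ring.
  under eq_bigr do rewrite exchange_big.
  rewrite exchange_big [RHS]mulr_sumr /=; apply: eq_bigr => j _.
  rewrite big_distrlr /= [X in N%:R^-1 * X]mulr_sumr [RHS]mulr_sumr.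
  apply: eq_bigr => i _; rewrite [X in N%:R^-1 * X]mulr_sumr [RHS]mulr_sumr.
  by apply: eq_bigr => l _.
have M0 : 0 <= M by apply: le_trans (hM 1 _); rewrite ?expr1n.
have N0' : 0 < N%:R :> C by rewrite ltr0n.
rewrite normrM normfV normr_nat ler_pdivrMl //.
apply: le_trans (ler_norm_sum _ _ _) _.
(* Parseval turns both squared norms into sums over [j]; what is left is the pointwise inequality
   between geometric and arithmetic means. *)
have -> : N%:R * (M * ((sqn u + sqn v) / 2)) =
    \sum_(j < N) M * ((`|U j| ^+ 2 + `|V j| ^+ 2) / 2).
  rewrite -mulr_sumr -mulr_suml big_split /= !(parseval _ pw) //.
  under eq_bigr do rewrite norm_conjC.
  by rewrite -mulrDr -/(sqn u) -/(sqn v); ring.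
apply: ler_sum => j _; rewrite !normrM normrX (norm_unity_root N0 (prim_expr_order pw)).
rewrite expr1n mul1r ler_pM ?mulr_ge0 ?hM //.
exact: (real_leif_mean_square (normr_real _) (normr_real _)).1.
Qed.

(** The diagonal carries the even-indexed coefficients. Their exponents [P.*2 - l.+1] are odd, so
    half the difference of the symbol at 1 and at -1 isolates them. *)
Lemma hankel_trace (P : nat) (c : nat -> C) (M : C) :
  (0 < P)%N ->
  (forall z, z ^+ P.*2 = 1 -> `|\sum_(l < P.*2) z ^+ (P.*2 - l.+1) * c l| <= M) ->
  `|\sum_(i < P) c (i + i)%N| <= M.
Proof.
move=> P0 hM.
have /hM h1 : 1 ^+ P.*2 = 1 :> C by rewrite expr1n.
have /hM h2 : (-1) ^+ P.*2 = 1 :> C by rewrite -signr_odd odd_double.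
have split2 (f : nat -> C) : \sum_(l < P.*2) f l = \sum_(i < P) (f i.*2 + f i.*2.+1).
  elim: (P) => [|k IH]; first by rewrite !big_ord0.
  by rewrite doubleS !big_ord_recr /= IH addrA.
have eq2 : \sum_(i < P) c (i + i)%N = (\sum_(l < P.*2) 1 ^+ (P.*2 - l.+1) * c l -
   \sum_(l < P.*2) (-1) ^+ (P.*2 - l.+1) * c l) / 2.
  rewrite (split2 (fun l => 1 ^+ (P.*2 - l.+1) * c l)).
  rewrite (split2 (fun l => (-1) ^+ (P.*2 - l.+1) * c l)).
  rewrite -sumrB mulr_suml; apply: eq_bigr => i _.
  have lP := ltn_ord i.
  have o1 : odd (P.*2 - i.*2.+1) = true by lia.
  have o2 : odd (P.*2 - i.*2.+2) = false by lia.
  rewrite -(signr_odd _ (P.*2 - i.*2.+1)) -(signr_odd _ (P.*2 - i.*2.+2)) o1 o2.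
  by rewrite !expr1n expr0 expr1 addnn; field.
rewrite eq2 normrM normfV normr_nat ler_pdivrMr ?ltr0n //.
apply: le_trans (ler_normB _ _) _.
by rewrite mulr_natr mulr2n lerD.
Qed.

End Hankel.

(** * Trace inequalities for sesquilinear forms *)

Section Traces.
Variable C : numClosedFieldType.

Definition sesq m n (u : 'cV[C]_m) (G : 'M[C]_(m, n)) (v : 'cV[C]_n) : C :=
  (u^t* *m G *m v) 0 0.

Lemma trmxCM m n p (A : 'M[C]_(m, n)) (B : 'M[C]_(n, p)) :
  (A *m B)^t* = B^t* *m A^t*.
Proof. by rewrite trmx_mul map_mxM. Qed.

Lemma trmxCB m n (A B : 'M[C]_(m, n)) : (A - B)^t* = A^t* - B^t*.
Proof. by rewrite [(A - B)^T]linearB map_mxB. Qed.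

Lemma trmxCD m n (A B : 'M[C]_(m, n)) : (A + B)^t* = A^t* + B^t*.
Proof. by rewrite [(A + B)^T]linearD map_mxD. Qed.

Lemma trmxCZ m n (a : C) (A : 'M[C]_(m, n)) : (a *: A)^t* = a^* *: A^t*.
Proof. by rewrite [(a *: A)^T]linearZ map_mxZ. Qed.

Lemma trmxC1 n : (1%:M : 'M[C]_n)^t* = 1%:M.
Proof. by rewrite trmx1 map_mx1. Qed.

Lemma sesqE n (u v : 'cV[C]_n) G :
  sesq u G v = \sum_i \sum_l (u i 0)^* * G i l * v l 0.
Proof.
rewrite /sesq mxE; under eq_bigr do rewrite mxE mulr_suml.
rewrite exchange_big; apply: eq_bigr => i _; apply: eq_bigr => l _.
by rewrite !mxE.
Qed.

Lemma sesq1 n (u : 'cV[C]_n) : sesq u 1%:M u = sqn u.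
Proof.
rewrite /sesq mulmx1 mxE; apply: eq_bigr => i _.
by rewrite !mxE normCK mulrC.
Qed.

Lemma sesq_mul m n p q (X : 'M[C]_(m, p)) (Y : 'M[C]_(n, q)) G u v :
  sesq (X *m u) G (Y *m v) = sesq u (X^t* *m G *m Y) v.
Proof. by rewrite /sesq trmxCM !mulmxA. Qed.

Lemma sesq_col m n p (X : 'M[C]_(m, p)) (Y : 'M[C]_(n, p)) G i j :
  sesq (col i X) G (col j Y) = (X^t* *m G *m Y) i j.
Proof.
rewrite /sesq -!mulmxA mxE [RHS]mxE; apply: eq_bigr => k _; rewrite !mxE.
by congr (_ * _); apply: eq_bigr => l _; rewrite !mxE.
Qed.

Lemma sesqD m n (u : 'cV[C]_m) (G H : 'M[C]_(m, n)) v :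
  sesq u (G + H) v = sesq u G v + sesq u H v.
Proof. by rewrite /sesq mulmxDr mulmxDl mxE. Qed.

Lemma sesqZ m n a (u : 'cV[C]_m) (G : 'M[C]_(m, n)) v :
  sesq u (a *: G) v = a * sesq u G v.
Proof. by rewrite /sesq -scalemxAr -scalemxAl mxE. Qed.

Lemma sesq_sum (I : finType) m n (u : 'cV[C]_m) (G : I -> 'M[C]_(m, n)) v :
  sesq u (\sum_i G i) v = \sum_i sesq u (G i) v.
Proof. by rewrite /sesq mulmx_sumr mulmx_suml summxE. Qed.

Lemma tr_sesq m n p (X : 'M[C]_(m, p)) (Y : 'M[C]_(n, p)) G :
  \tr (X^t* *m G *m Y) = \sum_i sesq (col i X) G (col i Y).
Proof. by apply: eq_bigr => i _; rewrite sesq_col. Qed.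

(** The adjoint of a Gram-Schmidt basis of the row space of [L]. Thus [Q *m Q^t*] is the orthogonal
    projection along the kernel of [L], and the number of columns of [Q] is what brings the rank
    into the trace bounds. *)
Lemma orthonormal_range s n (L : 'M[C]_(s, n)) :
  exists2 Q : 'M[C]_(n, \rank L), Q^t* *m Q = 1%:M & L *m (Q *m Q^t*) = L.
Proof.
pose U := schmidt (row_base L).
have UU : U *m U^t* = 1%:M.
  by apply/unitarymxP; rewrite schmidt_unitarymx ?rank_leq_col.
have /submxP[D LD] : (L <= U)%MS.
  by apply: submx_trans (schmidt_sub _); rewrite eq_row_base.
exists (U^t*); rewrite trmxCK //.
have : D *m U *m (U^t* *m U) = D *m U by rewrite -!mulmxA (mulmxA U) UU mul1mx.
by rewrite -LD.
Qed.

Lemma sqn_col_orthonormal m n (Q : 'M[C]_(n, m)) i :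
  Q^t* *m Q = 1%:M -> sqn (col i Q) = 1.
Proof. by move=> QQ; rewrite -sesq1 sesq_col mulmx1 QQ mxE eqxx. Qed.

Section Involution.
Variables (n : nat) (F : 'M[C]_n).
Hypotheses (Fherm : F^t* = F) (F3 : F *m F *m F = F).

(* [F ^ 2] is a projection, and half of [F ^ 2 - e F] is one too when [e ^ 2 = 1];
   so this squares to [1 - F ^ 2 + (F ^ 2 - e F)]. *)
Definition sqrt_one_sub (e : C) : 'M[C]_n :=
  1%:M - F *m F + (sqrtC 2)^-1 *: (F *m F - e *: F).

Lemma sqrt_one_sub_herm e : e^* = e -> (sqrt_one_sub e)^t* = sqrt_one_sub e.
Proof.
move=> er; rewrite /sqrt_one_sub trmxCD trmxCZ !trmxCB trmxCZ trmxCM Fherm trmxC1 er.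
by rewrite fmorphV /= geC0_conj // sqrtC_ge0.
Qed.

Lemma sqrt_one_sub_sqr e : e ^+ 2 = 1 ->
  sqrt_one_sub e *m sqrt_one_sub e = 1%:M - e *: F.
Proof.
move=> e2; rewrite /sqrt_one_sub; set E := F *m F; set a := (sqrtC 2)^-1.
have EF : E *m F = F by [].
have FE : F *m E = F by rewrite mulmxA.
have EE : E *m E = E by rewrite {2}/E mulmxA EF.
have a2 : a * a = 2^-1 by rewrite -invfM -expr2 sqrtCK.
have X0 : (1%:M - E) *m (E - e *: F) = 0.
  by rewrite mulmxBl mul1mx mulmxBr EE -scalemxAr EF subrr.
have X1 : (E - e *: F) *m (1%:M - E) = 0.
  by rewrite mulmxBr mulmx1 mulmxBl EE -scalemxAl FE subrr.
have X2 : (E - e *: F) *m (E - e *: F) = 2 *: (E - e *: F).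
  rewrite mulmxBr !mulmxBl -!scalemxAr -!scalemxAl EE EF FE scalerA -expr2 e2.
  by rewrite scale1r scaler_nat mulr2n opprB.
have X3 : (1%:M - E) *m (1%:M - E) = 1%:M - E.
  by rewrite mulmxBr mulmx1 mulmxBl EE mul1mx subrr subr0.
rewrite (mulmxDr _ (1%:M - E)) !(mulmxDl (1%:M - E)) -!scalemxAr -!scalemxAl X0 X1 X2 X3 !scaler0 addr0 add0r.
by rewrite !scalerA a2 mulVf ?pnatr_eq0 // scale1r addrA subrK.
Qed.

Lemma sqn_sqrt_one_sub e u : e ^+ 2 = 1 -> e^* = e ->
  sqn (sqrt_one_sub e *m u) = sqn u - e * sesq u F u.
Proof.
move=> e2 er; rewrite -sesq1 sesq_mul mulmx1 sqrt_one_sub_herm // sqrt_one_sub_sqr //.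
by rewrite -scaleNr sesqD sesqZ sesq1 mulNr.
Qed.

(** The squares of the roots for [e] and [- e] add up to 2, so the defect is the squared norm given
    by the other sign. *)
Lemma sqn_sqrt_one_sub_le e u : e ^+ 2 = 1 -> e^* = e ->
  sqn (sqrt_one_sub e *m u) <= 2 * sqn u.
Proof.
move=> e2 er; rewrite -subr_ge0 sqn_sqrt_one_sub //.
have -> : 2 * sqn u - (sqn u - e * sesq u F u) = sqn (sqrt_one_sub (- e) *m u).
  by rewrite sqn_sqrt_one_sub ?sqrrN ?rmorphN /= ?er //; ring.
exact: sqn_ge0.
Qed.

(** [F *m F] is an orthogonal projection, so Pythagoras applies to it and its complement. *)
Lemma sqn_involution_le u : sqn (F *m u) <= sqn u.
Proof.
have -> : sqn u = sqn (F *m u) + sqn ((1%:M - F *m F) *m u).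
  rewrite -!sesq1 !sesq_mul !mulmx1 Fherm -sesqD trmxCB trmxCM Fherm trmxC1.
  congr (sesq _ _ _); rewrite mulmxBr mulmx1 mulmxBl mul1mx mulmxA F3 subrr subr0.
  by rewrite addrC subrK.
by rewrite lerDl sqn_ge0.
Qed.

(** Inserting the projection onto the row space of [G] reduces the trace to [\rank G] terms, each at
    most [M] because [F] is a contraction and the columns of [Q] are unit vectors. *)
Lemma norm_tr_mul_rank_le (G : 'M[C]_n) (M : C) : 0 <= M ->
  (forall u v, `|sesq u G v| <= M * ((sqn u + sqn v) / 2)) ->
  `|\tr (G *m F)| <= (\rank G)%:R * M.
Proof.
move=> M0 hG; have [Q QQ GQ] := orthonormal_range G.
have -> : \tr (G *m F) = \sum_i sesq (F *m col i Q) G (col i Q).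
  rewrite -{1}GQ -mulmxA mxtrace_mulC -!mulmxA mxtrace_mulC !mulmxA.
  rewrite (_ : Q^t* *m F *m G *m Q = (F *m Q)^t* *m G *m Q).
    by rewrite tr_sesq; apply: eq_bigr => i _; rewrite !colE mulmxA.
  by rewrite trmxCM Fherm.
apply: le_trans (ler_norm_sum _ _ _) _.
rewrite mulr_natl -[X in _ *+ X]card_ord -sumr_const; apply: ler_sum => i _.
apply: le_trans (hG _ _) _; rewrite ler_piMr // ler_pdivrMr ?ltr0n // mul1r.
rewrite (sqn_col_orthonormal i QQ) -[2]/(1 + 1) lerD2r.
by rewrite (le_trans (sqn_involution_le _)) // sqn_col_orthonormal.
Qed.

End Involution.

(** The trace splits along the kernel of [L], where every term is nonnegative, and its orthogonal
    complement, where there are [\rank L] terms, each at least [- c]. *)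
Lemma Re_tr_ge n s (H : 'M[C]_n) (L : 'M[C]_(s, n)) (c : C) :
  (forall u, - (c * sqn u) <= 'Re (sesq u H u)) ->
  (forall u, L *m u = 0 -> 0 <= 'Re (sesq u H u)) ->
  - ((\rank L)%:R * c) <= 'Re (\tr H).
Proof.
move=> hneg hpos; have [Q QQ LQ] := orthonormal_range L.
pose K : 'M[C]_n := 1%:M - Q *m Q^t*.
have Kherm : K^t* = K.
  by rewrite trmxCB trmxCM trmxCK trmxC1.
have KK : K *m K = K.
  rewrite /K mulmxBr mulmx1 mulmxBl mul1mx -mulmxA (mulmxA (Q^t*)) QQ mul1mx.
  by rewrite subrr subr0.
have -> : \tr H = \tr (K^t* *m H *m K) + \tr (Q^t* *m H *m Q).
  rewrite mxtrace_mulC mulmxA Kherm KK mulmxBl mul1mx linearB /=.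
  by rewrite -[Q *m _ *m _]mulmxA [\tr (Q *m _)]mxtrace_mulC subrK.
rewrite !tr_sesq raddfD -[leLHS]add0r lerD //.
  rewrite raddf_sum sumr_ge0 // => i _; apply: hpos.
  by rewrite colE mulmxA mulmxBr mulmx1 LQ subrr mul0mx.
rewrite raddf_sum mulr_natl -[X in _ *+ X]card_ord -sumr_const -sumrN.
apply: ler_sum => i _; apply: le_trans (hneg _).
by rewrite sqn_col_orthonormal // mulr1.
Qed.

(* Conjugating by the square root of [1 - e F], rather than splitting it, is what
   keeps the constant at 2: its norm squared is at most 2. *)
Lemma Re_tr_mul_le n s (G F : 'M[C]_n) (L : 'M[C]_(s, n)) (M e : C) :
  F^t* = F -> F *m F *m F = F -> e ^+ 2 = 1 -> e^* = e -> 0 <= M ->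
  (forall u v, `|sesq u G v| <= M * ((sqn u + sqn v) / 2)) ->
  (forall u, L *m u = 0 -> 0 <= 'Re (sesq u G u)) ->
  'Re (e * \tr (G *m F)) <= 'Re (\tr G) + (\rank L)%:R * (2 * M).
Proof.
move=> Fh F3 e2 er M0 hG hpos; pose S := sqrt_one_sub F e.
have Sh : S^t* = S by apply: sqrt_one_sub_herm.
have Su u : sesq u (S *m G *m S) u = sesq (S *m u) G (S *m u).
  by rewrite sesq_mul Sh.
(* The form of [S *m G *m S] at [u] is that of [G] at [S *m u], so it is nonnegative on the kernel
   of [L *m S], whose rank is at most that of [L]. *)
have ineq : - ((\rank (L *m S))%:R * (2 * M)) <= 'Re (\tr (S *m G *m S)).
  apply: Re_tr_ge => u; last by rewrite Su -mulmxA; apply: hpos.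
  rewrite Su; set v := S *m u.
  have : `|sesq v G v| <= 2 * M * sqn u.
    apply: le_trans (hG v v) _; rewrite [2 * M]mulrC -mulrA ler_wpM2l //.
    rewrite -[in X in X / 2](mulr1 (sqn v)) -mulrDr mulfK ?pnatr_eq0 //.
    exact: sqn_sqrt_one_sub_le.
  move=> le_v; rewrite lerNl -raddfN; apply: le_trans le_v.
  by rewrite -normrN (leif_Re_Creal _).1.
(* By cyclicity the trace of [S *m G *m S] is that of [(1 - e F) G]. *)
move: ineq; rewrite mxtrace_mulC mulmxA sqrt_one_sub_sqr // mulmxBl mul1mx -scalemxAl.
rewrite linearB linearZ /= [\tr (F *m G)]mxtrace_mulC raddfB /= lerBrDr addrC lerBlDr.
move/le_trans; apply; rewrite lerD2l ler_wpM2r ?mulr_ge0 // ler_nat.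
exact: mxrankM_maxl.
Qed.

End Traces.

(** * Pairing a Hankel matrix with the flip *)

Section Flip.
Variable C : numClosedFieldType.

(** Reverses the indices [0..k] and kills the others, so it is only a partial involution, with cube
    equal to itself. Keeping [n] apart from [k] lets the size grow while the power stays fixed. *)
Definition flip (n k : nat) : 'M[C]_n := \matrix_(i, j) (i + j == k)%N%:R.

Lemma flip_herm n k : (flip n k)^t* = flip n k.
Proof. by apply/matrixP => i j; rewrite !mxE conjC_nat addnC. Qed.

Lemma sum_flip n k (i : nat) (f : nat -> C) : (k < n)%N ->
  \sum_(j < n) (i + j == k)%N%:R * f j = (i <= k)%N%:R * f (k - i)%N.
Proof.
move=> kn; have [ik|ki] := leqP i k; last first.
  by rewrite mul0r big1 // => j _; rewrite (_ : _ == _ = false) ?mul0r //; lia.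
have kin : (k - i < n)%N by lia.
rewrite (bigD1 (Ordinal kin)) //= subnKC // eqxx big1 ?addr0 // => j nj.
rewrite (_ : _ == _ = false) ?mul0r //.
by apply: contraNF nj => /eqP e; apply/eqP/val_inj; rewrite /= -e addKn.
Qed.

Lemma flip3 n k : (k < n)%N -> flip n k *m flip n k *m flip n k = flip n k.
Proof.
move=> kn; apply/matrixP => i j; rewrite -mulmxA !mxE.
transitivity (\sum_(l < n) (i + l == k)%N%:R * ((l <= k)%N%:R * (k - l + j == k)%N%:R) : C).
  apply: eq_bigr => l _; rewrite !mxE -(@sum_flip n k _ (fun m => (m + j == k)%N%:R)) //.
  by congr (_ * _); apply: eq_bigr => m _; rewrite !mxE.
rewrite (sum_flip _ (fun l => (l <= k)%N%:R * (k - l + j == k)%N%:R)) //.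
rewrite leq_subr mul1r -natrM mulnb.
by congr (nat_of_bool _)%:R; have [ik|ki] := leqP i k => /=; lia.
Qed.

Definition hankel (n : nat) (c : nat -> C) : 'M[C]_n := \matrix_(i, j) c (i + j)%N.

Lemma tr_hankel_flip n k c : (k < n)%N -> \tr (hankel n c *m flip n k) = k.+1%:R * c k.
Proof.
move=> kn; rewrite /mxtrace.
transitivity (\sum_(i < n) (i <= k)%N%:R * c k : C).
  apply: eq_bigr => i _; rewrite mxE.
  transitivity (\sum_(j < n) (i + j == k)%N%:R * c (i + j)%N : C).
    by apply: eq_bigr => j _; rewrite !mxE mulrC [(j + i)%N]addnC.
  rewrite (sum_flip i (fun j => c (i + j)%N)) //.
  by have [ik|ki] := leqP i k; rewrite ?mul0r // subnKC.
rewrite -mulr_suml; congr (_ * _); rewrite -natr_sum; congr _%:R.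
have -> m : (\sum_(i < m) nat_of_bool (i <= k) = minn m k.+1)%N.
  elim: m => [|m IH]; first by rewrite big_ord0 min0n.
  by rewrite big_ord_recr /= IH; lia.
by lia.
Qed.

Lemma sesq_hankel n (c : nat -> C) (u v : 'cV[C]_n) :
  sesq u (hankel n c) v = \sum_(i < n) \sum_(l < n) (u i 0)^* * c (i + l)%N * v l 0.
Proof.
by rewrite sesqE; apply: eq_bigr => i _; apply: eq_bigr => l _; rewrite mxE.
Qed.

Section Bounds.
Variables (n k : nat) (c : nat -> C) (M : C).
Hypothesis kn : (k < n)%N.
Hypothesis hM : forall z, z ^+ n.*2 = 1 ->
  `|\sum_(l < n.*2) z ^+ (n.*2 - l.+1) * c l| <= M.

Let M0 : 0 <= M.
Proof. by apply: le_trans (hM (z := 1) _); rewrite ?expr1n. Qed.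

Lemma sesq_hankel_le u v : `|sesq u (hankel n c) v| <= M * ((sqn u + sqn v) / 2).
Proof. by rewrite sesq_hankel; apply: (hankel_bound (N := n.*2)) => //; lia. Qed.

(** The coefficient is the entry [(0, k)], read off with two unit vectors. *)
Lemma hankel_coef_le : `|c k| <= M.
Proof.
have n0 : (0 < n)%N by lia.
have sqd (i : 'I_n) : sqn (delta_mx i 0 : 'cV[C]_n) = 1.
  rewrite /sqn (bigD1 i) //= mxE !eqxx normr1 expr1n big1 ?addr0 // => j nj.
  by rewrite mxE (negPf nj) normr0 expr0n.
have := sesq_hankel_le (delta_mx (Ordinal n0) 0) (delta_mx (Ordinal kn) 0).
rewrite !sqd -[1 + 1]/2 divff ?pnatr_eq0 // mulr1.
by rewrite /sesq trmx_delta map_delta_mx -rowE -colE !mxE.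
Qed.

Lemma hankel_rank_le : k.+1%:R * `|c k| <= (\rank (hankel n c))%:R * M.
Proof.
rewrite -[k.+1%:R]normr_nat -normrM -(tr_hankel_flip _ kn).
by apply: (norm_tr_mul_rank_le (flip_herm _ _) (flip3 kn)) => // u v; exact: sesq_hankel_le.
Qed.

(** In [2 * \rank L + 1] the 1 pays for the trace of the Hankel matrix itself, and [2 * \rank L] for
    the directions on which its form may be negative. *)
Lemma hankel_inertia_le s (L : 'M[C]_(s, n)) :
  (forall u, L *m u = 0 -> 0 <= 'Re (sesq u (hankel n c) u)) ->
  k.+1%:R * `|'Re (c k)| <= (2 * \rank L + 1)%:R * M.
Proof.
move=> hpos.
have tr_le : 'Re (\tr (hankel n c)) <= M.
  apply: le_trans (leif_Re_Creal _).1 _.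
  rewrite /mxtrace; under eq_bigr do rewrite mxE.
  by apply: hankel_trace => //; lia.
(* Used for [e = 1] and [e = -1], which together bound the absolute value. *)
have side e : e ^+ 2 = 1 -> e^* = e ->
    'Re (e * (k.+1%:R * c k)) <= (2 * \rank L + 1)%:R * M.
  move=> e2 er; rewrite -(tr_hankel_flip _ kn).
  apply: le_trans (Re_tr_mul_le (flip_herm _ _) (flip3 kn) e2 er M0 _ hpos) _.
    by move=> u v; exact: sesq_hankel_le.
  have -> : (2 * \rank L + 1)%:R * M = M + (\rank L)%:R * (2 * M).
    by rewrite natrD natrM; ring.
  by rewrite lerD2r.
rewrite -[k.+1%:R]normr_nat -normrM -ReMl ?realn // real_ler_norml ?Creal_Re //.
rewrite lerNl -raddfN -mulN1r -{2}[_ * c k]mul1r !side ?sqrrN ?expr1n ?rmorphN ?rmorph1 //.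
Qed.

End Bounds.
End Flip.

(** * Resolvents and Hankel matrices of powers *)

Section Powers.
Variables (C : numClosedFieldType) (n : nat) (B : 'M[C]_n.+1).

(** The factorization of [z^N - B^N] by [z - B], where [z^N = 1]: an exact finite substitute for the
    Neumann series. *)
Lemma resolvent_geom N z : z ^+ N = 1 -> z%:M - B \in unitmx ->
  \sum_(l < N) z ^+ (N - l.+1) *: B ^+ l = invmx (z%:M - B) *m (1%:M - B ^+ N).
Proof.
move=> zN zB.
have cB : GRing.comm (z%:M : 'M[C]_n.+1) B by apply/esym/scalar_mxC.
have := subrXX_comm N cB.
rewrite -rmorphXn zN rmorph1 => ->.
rewrite mulmxA mulVmx // mul1mx; apply: eq_bigr => l _.
rewrite -rmorphXn /= -mul_scalar_mx (_ : (N - l.+1)%N = (N.-1 - l)%N) //; lia.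
Qed.

(** Expanding the second factor of [B^i B^j] over the [d] matrices [W t] factors the Hankel matrix
    through dimension [d]. *)
Lemma rank_hankel_powers_le d m (h : nat -> 'I_d -> C) (W : 'I_d -> 'M[C]_n.+1) x y :
  (forall l, B ^+ l = \sum_t h l t *: W t) ->
  (\rank (hankel m (fun l => sesq y (B ^+ l) x)) <= d)%N.
Proof.
move=> hW.
pose X : 'M[C]_(m, d) := \matrix_(i, t) sesq y (B ^+ i *m W t) x.
pose Y : 'M[C]_(d, m) := \matrix_(t, j) h j t.
have -> : hankel m (fun l => sesq y (B ^+ l) x) = X *m Y.
  apply/matrixP => i j; rewrite !mxE exprD (hW j) mulr_sumr.
  rewrite sesq_sum; apply: eq_bigr => t _.
  by rewrite !mxE -scalerAr sesqZ mulrC.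
by rewrite (leq_trans (mxrankM_maxl _ _)) ?rank_leq_col.
Qed.
End Powers.

(** * Euclidean and spectral norms, with real-valued moduli *)

Section EuclideanNorm.
Variable R : realType.
Implicit Types (n : nat) (z : R[i]).

Lemma normCE z : `|z| = (cmod z)%:C%C.
Proof. by []. Qed.

Lemma cmod_ge0 z : 0 <= cmod z.
Proof. by rewrite -ler0c -normCE normr_ge0. Qed.

Lemma cauchy_schwarz n (a b : 'I_n -> R) :
  (forall i, 0 <= a i) -> (forall i, 0 <= b i) ->
  \sum_i a i * b i <= Num.sqrt (\sum_i a i ^+ 2) * Num.sqrt (\sum_i b i ^+ 2).
Proof.
move=> a0 b0; set X := \sum_i a i ^+ 2; set Y := \sum_i b i ^+ 2.
have vanish (f : 'I_n -> R) : (forall i, 0 <= f i) -> \sum_i f i ^+ 2 <= 0 ->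
    forall i, f i = 0.
  move=> f0 fle i; apply/eqP; rewrite -sqrf_eq0 eq_le sqr_ge0 andbT.
  by apply: le_trans fle; rewrite (bigD1 i) //= lerDl sumr_ge0 // => j _; rewrite sqr_ge0.
have [X0|X0] := leP X 0.
  by rewrite big1 ?mulr_ge0 ?sqrtr_ge0 // => i _; rewrite (vanish a) ?mul0r.
have [Y0|Y0] := leP Y 0.
  by rewrite big1 ?mulr_ge0 ?sqrtr_ge0 // => i _; rewrite (vanish b) ?mulr0.
pose x := Num.sqrt X; pose y := Num.sqrt Y.
have x0 : 0 < x by rewrite sqrtr_gt0.
have y0 : 0 < y by rewrite sqrtr_gt0.
have xx : x ^+ 2 = X by rewrite sqr_sqrtr // ltW.
have yy : y ^+ 2 = Y by rewrite sqr_sqrtr // ltW.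
(* The weights [y / x] and [x / y] balance the two norms, so that the termwise mean inequality sums
   to exactly [x * y]. *)
apply: (@le_trans _ _ (\sum_i (a i ^+ 2 * (y / x) + b i ^+ 2 * (x / y)) / 2)).
  apply: ler_sum => i _; rewrite -subr_ge0.
  have -> : (a i ^+ 2 * (y / x) + b i ^+ 2 * (x / y)) / 2 - a i * b i =
     (a i * y - b i * x) ^+ 2 / (2 * x * y).
    by field; rewrite !gt_eqF.
  by rewrite divr_ge0 ?sqr_ge0 // !mulr_ge0 // ltW.
rewrite -mulr_suml big_split /= -!mulr_suml -/X -/Y -/x -/y -xx -yy.
by rewrite le_eqVlt; apply/orP; left; apply/eqP; field; rewrite !gt_eqF.
Qed.

Lemma enorm2_ge0 n (x : 'cV[R[i]]_n) : 0 <= enorm2 x.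
Proof. exact: sqrtr_ge0. Qed.

Lemma enorm2_sqr n (x : 'cV[R[i]]_n) : enorm2 x ^+ 2 = \sum_i cmod (x i 0) ^+ 2.
Proof. by rewrite sqr_sqrtr // sumr_ge0 // => i _; rewrite sqr_ge0. Qed.

Lemma sqnE n (x : 'cV[R[i]]_n) : sqn x = (enorm2 x ^+ 2)%:C%C.
Proof.
rewrite enorm2_sqr rmorph_sum; apply: eq_bigr => i _.
by rewrite normCE -rmorphXn.
Qed.

Lemma cmod_sum_le (I : finType) (f : I -> R[i]) : cmod (\sum_i f i) <= \sum_i cmod (f i).
Proof.
by rewrite -lecR rmorph_sum -normCE; apply: ler_norm_sum.
Qed.

Lemma cmodM (z w : R[i]) : cmod (z * w) = cmod z * cmod w.
Proof. exact: Normc.normcM. Qed.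

Lemma cmod_real (a : R) : 0 <= a -> cmod a%:C%C = a.
Proof. by move=> a0; apply: complexI; rewrite -normCE ger0_norm ?ler0c. Qed.

Lemma cmodX z k : cmod (z ^+ k) = cmod z ^+ k.
Proof. by apply: complexI; rewrite rmorphXn /= -!normCE normrX. Qed.

Lemma cmod_conj z : cmod (z^*) = cmod z.
Proof. by apply: complexI; rewrite -!normCE norm_conjC. Qed.

Lemma cmod_sesq1_le n (x y : 'cV[R[i]]_n) :
  cmod (sesq y 1%:M x) <= enorm2 y * enorm2 x.
Proof.
apply: le_trans (cauchy_schwarz _ _) => [|i|i]; rewrite ?cmod_ge0 //.
rewrite /sesq mulmx1 mxE; apply: le_trans (cmod_sum_le _) _.
by apply: ler_sum => i _; rewrite cmodM !mxE cmod_conj.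
Qed.

Lemma enorm2Z n a (x : 'cV[R[i]]_n) : enorm2 (a *: x) = cmod a * enorm2 x.
Proof.
rewrite /enorm2 -[X in X * _]ger0_norm ?cmod_ge0 // -sqrtr_sqr -sqrtrM ?sqr_ge0 //.
by rewrite mulr_sumr; congr Num.sqrt; apply: eq_bigr => i _; rewrite mxE cmodM exprMn.
Qed.

Lemma enorm2D n (x y : 'cV[R[i]]_n) : enorm2 (x + y) <= enorm2 x + enorm2 y.
Proof.
rewrite -(ler_pXn2r (n := 2)) ?nnegrE ?addr_ge0 ?enorm2_ge0 // sqrrD !enorm2_sqr.
apply: (@le_trans _ _ (\sum_i (cmod (x i 0) + cmod (y i 0)) ^+ 2)).
  apply: ler_sum => i _; rewrite mxE ler_pXn2r ?nnegrE ?addr_ge0 ?cmod_ge0 //.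
  exact: le_normcD.
under eq_bigr do rewrite sqrrD.
rewrite !big_split /= lerD2r lerD2l -mulr2n ler_pMn2r //.
by apply: cauchy_schwarz => i; apply: cmod_ge0.
Qed.

Lemma enorm2N n (x : 'cV[R[i]]_n) : enorm2 (- x) = enorm2 x.
Proof. by rewrite -scaleN1r enorm2Z -[cmod _]/(Normc.normc (-1)) normcN Normc.normc1 mul1r. Qed.

(** The Frobenius norm serves as [F]; this makes the supremum in [specnorm] one of a bounded set. *)
Lemma enorm2_mulmx_bounded n (A : 'M[R[i]]_n) :
  exists2 F, 0 <= F & forall x, enorm2 (A *m x) <= F * enorm2 x.
Proof.
pose r i := Num.sqrt (\sum_j cmod (A i j) ^+ 2).
exists (Num.sqrt (\sum_i r i ^+ 2)) => [|x]; first exact: sqrtr_ge0.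
rewrite -(ler_pXn2r (n := 2)) ?nnegrE ?mulr_ge0 ?enorm2_ge0 ?sqrtr_ge0 //.
rewrite exprMn [in leLHS]enorm2_sqr sqr_sqrtr ?sumr_ge0 // => [|i _]; last exact: sqr_ge0.
rewrite mulr_suml; apply: ler_sum => i _; rewrite -exprMn.
rewrite ler_pXn2r ?nnegrE ?mulr_ge0 ?enorm2_ge0 ?sqrtr_ge0 ?cmod_ge0 //.
rewrite mxE; apply: le_trans (cmod_sum_le _) _.
under eq_bigr do rewrite cmodM.
by apply: cauchy_schwarz => j; apply: cmod_ge0.
Qed.

Lemma enorm2_0 n : enorm2 (0 : 'cV[R[i]]_n) = 0.
Proof. by rewrite -(scale0r 0) enorm2Z Normc.normc0 mul0r. Qed.

Lemma enorm2_eq0 n (x : 'cV[R[i]]_n) : enorm2 x = 0 -> x = 0.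
Proof.
move=> x0; apply/colP => i; rewrite mxE; apply: Normc.eq0_normc; apply/eqP.
have := enorm2_sqr x; rewrite x0 expr0n => /esym/eqP.
by rewrite psumr_eq0 => [/allP/(_ i (mem_index_enum _))|j _]; rewrite ?sqrf_eq0 ?sqr_ge0.
Qed.

Lemma specnorm_le n (A : 'M[R[i]]_n) c :
  (forall x, enorm2 x <= 1 -> enorm2 (A *m x) <= c) -> specnorm A <= c.
Proof.
move=> hc; apply: ge_sup => [|_ [x /= x1 <-]]; last exact: hc.
by exists (enorm2 (A *m 0)); exists 0 => //=; rewrite enorm2_0.
Qed.

Lemma specnorm_ge n (A : 'M[R[i]]_n) x : enorm2 x <= 1 -> enorm2 (A *m x) <= specnorm A.
Proof.
move=> x1; apply: ub_le_sup; last by exists x.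
have [F F0 hF] := enorm2_mulmx_bounded A.
by exists F => _ [y /= y1 <-]; apply: le_trans (hF y) _; rewrite ler_piMr.
Qed.

Lemma specnorm_ge0 n (A : 'M[R[i]]_n) : 0 <= specnorm A.
Proof.
by apply: le_trans (enorm2_ge0 (A *m 0)) _; rewrite specnorm_ge // enorm2_0.
Qed.

Lemma enorm2_mulmx_le n (A : 'M[R[i]]_n) x : enorm2 (A *m x) <= specnorm A * enorm2 x.
Proof.
have [x0|x0] := eqVneq (enorm2 x) 0.
  by rewrite (enorm2_eq0 x0) mulmx0 enorm2_0 mulr0.
have xp : 0 < enorm2 x by rewrite lt_def x0 enorm2_ge0.
rewrite -ler_pdivrMr // mulrC.
have cN : cmod ((enorm2 x)^-1)%:C%C = (enorm2 x)^-1.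
  by rewrite cmod_real // invr_ge0 ltW.
rewrite -[X in X * _]cN -enorm2Z scalemxAr specnorm_ge // enorm2Z cN.
by rewrite mulVf.
Qed.

End EuclideanNorm.

(** * From inertia to ranks *)

Section Inertia.
Variable R : realType.

Lemma rank_diag_mx_le (F : fieldType) n (d : 'rV[F]_n) :
  (\rank (diag_mx d) <= #|[pred i | d 0%R i != 0%R]|)%N.
Proof.
have -> : diag_mx d = \sum_(i | d 0 i != 0) d 0 i *: delta_mx i i.
  rewrite diag_mx_sum_delta [LHS](bigID (fun i => d 0 i != 0)) /= [X in _ + X]big1 ?addr0 //.
  by move=> i /negPn/eqP->; rewrite scale0r.
rewrite -sum1_card; elim/big_ind2: _ => [|A k B l hA hB|i _]; first by rewrite mxrank0.
  exact: leq_trans (mxrank_add _ _) (leq_add hA hB).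
by rewrite (leq_trans (mxrank_scale _ _)) // mxrank_delta.
Qed.

Lemma char_poly_conj (F : fieldType) n (P D : 'M[F]_n) : P \in unitmx ->
  char_poly (invmx P *m D *m P) = char_poly D.
Proof.
move=> uP; rewrite /char_poly.
have -> : char_poly_mx (invmx P *m D *m P) =
    map_mx polyC (invmx P) *m char_poly_mx D *m map_mx polyC P.
  rewrite /char_poly_mx mulmxBr mulmxBl -!map_mxM; congr (_ - _).
  by rewrite -mulmxA mul_scalar_mx -scalemxAr -map_mxM mulVmx // map_mx1 scalemx1.
rewrite !det_mulmx mulrAC -det_mulmx -map_mxM mulVmx //.
by rewrite map_mx1 det1 mul1r.
Qed.

Lemma char_poly_diag (F : fieldType) n (d : 'rV[F]_n) :
  char_poly (diag_mx d) = \prod_i ('X - (d 0 i)%:P).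
Proof.
rewrite char_poly_trig ?diag_mx_is_trig //.
by apply: eq_bigr => i _; rewrite mxE eqxx.
Qed.

(** [eigenvalues] has an unspecified order, but unique factorization makes it a permutation of [d],
    and counting ignores order. *)
Lemma count_eigenvalues n (J : 'M[R[i]]_n) (d : 'rV_n) (a : pred R[i]) :
  char_poly J = \prod_i ('X - (d 0 i)%:P) ->
  count a (eigenvalues J) = #|[pred i | a (d 0 i)]|.
Proof.
move=> cJ; rewrite /eigenvalues; case: closed_field_poly_normal => s /= hs.
rewrite (monicP (char_poly_monic _)) scale1r cJ in hs.
have /permP -> : perm_eq s [seq d 0 i | i <- enum 'I_n].
  apply: prod_XsubC_eq; rewrite -hs big_map big_enum.
  by apply: eq_bigl => i.
by rewrite count_map enumT cardE /enum_mem size_filter -enumT enumT; apply: eq_count => i.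
Qed.

(** In a spectral basis [J] is diagonal with entries 1 or -1, so [1 - J] is nonzero only at the
    entries -1 and [1 + J] only at the entries 1. *)
Lemma involution_rank_le n (J : 'M[R[i]]_n) : J^t* = J -> J *m J = 1%:M ->
  (\rank (1%:M - J)%R <= num_neg_eig J)%N /\ (\rank (1%:M + J)%R <= num_pos_eig J)%N.
Proof.
move=> Jh JJ.
have /orthomx_spectralP : J \is normalmx by apply/normalmxP; rewrite Jh.
have := spectral_unit J; move: (spectralmx J) (spectral_diag J) => P d uP JE.
have d2 i : d 0 i = 1 \/ d 0 i = -1.
  have : diag_mx d *m diag_mx d = 1%:M.
    have := congr1 (fun X => P *m X *m invmx P) JJ.
    rewrite {1 2}JE mulmx1 mulmxV // !mulmxA mulmxV // mul1mx !mulmxK //.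
  move/matrixP/(_ i i); rewrite mul_diag_mx !mxE eqxx mulr1n => /eqP.
  by rewrite -expr2 sqrf_eq1 => /orP[]/eqP; auto.
have cJ : char_poly J = \prod_i ('X - (d 0 i)%:P).
  by rewrite {1}JE char_poly_conj // char_poly_diag.
have rk (e : R[i]) : (\rank (1%:M + e *: J)%R <= #|[pred i | (1 + e * d 0 i != 0)%R]|)%N.
  have -> : 1%:M + e *: J = invmx P *m diag_mx (const_mx 1 + e *: d) *m P.
    rewrite raddfD /= diag_const_mx mulmxDr mulmxDl mulmx1 mulVmx //; congr (_ + _).
    by rewrite {1}JE linearZ /= -scalemxAr -scalemxAl.
  apply: leq_trans (mxrankM_maxl _ _) _; apply: leq_trans (mxrankM_maxr _ _) _.
  apply: leq_trans (rank_diag_mx_le _) _.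
  by apply/subset_leq_card/fintype.subsetP => i; rewrite !inE !mxE.
split.
  have := rk (-1); rewrite scaleN1r => /leq_trans; apply.
  rewrite /num_neg_eig (count_eigenvalues _ cJ); apply/subset_leq_card/fintype.subsetP => i.
  rewrite !inE; case: (d2 i) => ->; first by rewrite mulr1 subrr eqxx.
  by rewrite ltrN10.
have := rk 1; rewrite scale1r => /leq_trans; apply.
rewrite /num_pos_eig (count_eigenvalues _ cJ); apply/subset_leq_card/fintype.subsetP => i.
rewrite !inE; case: (d2 i) => ->; first by rewrite ltr01.
by rewrite mul1r subrr eqxx.
Qed.

End Inertia.

(** * Growth of powers from the location of the spectrum *)

Section Growth.
Variables (R : realType) (n : nat) (A : 'M[R[i]]_n.+1).

(** Linear factors are peeled off one at a time: [(A - z) x] is annihilated by one factor fewer, and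
    each peeling costs a constant, not a larger base [t]. *)
Lemma annihilated_power_growth (t : R) (s : seq R[i]) x : 1 < t ->
  (forall z, z \in s -> cmod z <= 1) ->
  horner_mx A (\prod_(z <- s) ('X - z%:P)) *m x = 0 ->
  exists C, forall N, enorm2 (A ^+ N *m x) <= C * t ^+ N.
Proof.
move=> t1; elim: s x => [|z s IH] x hs.
  rewrite big_nil rmorph1 mul1mx => ->; exists 0 => N.
  by rewrite mulmx0 enorm2_0 mul0r.
rewrite big_cons mulrC rmorphM rmorphB /= horner_mx_X horner_mx_C -mulmxA => hx.
have [|C hC] := IH _ _ hx; first by move=> w ws; apply: hs; rewrite inE ws orbT.
have C0 : 0 <= C.
  by have := hC 0%N; rewrite !expr0 mulr1; apply: le_trans; apply: enorm2_ge0.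
have t0 : 0 < t - 1 by rewrite subr_gt0.
(* The new constant [D] must satisfy [D + C <= D * t] for the induction step, whence [C / (t - 1)],
   and dominate [enorm2 x] at [N = 0]. *)
exists (enorm2 x + C / (t - 1)); elim=> [|N IHN].
  by rewrite !expr0 mul1mx mulr1 lerDl divr_ge0 // ltW.
have -> : A ^+ N.+1 *m x = z *: (A ^+ N *m x) + A ^+ N *m ((A - z%:M) *m x).
  rewrite mulmxBl mulmxBr mul_scalar_mx -scalemxAr addrC subrK mulmxA.
  by rewrite exprSr.
apply: le_trans (enorm2D _ _) _; rewrite enorm2Z.
apply: (@le_trans _ _ ((enorm2 x + C / (t - 1)) * t ^+ N + C * t ^+ N)).
  apply: lerD (hC N); apply: le_trans IHN.
  by rewrite ler_piMl ?enorm2_ge0 // hs // inE eqxx.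
rewrite -mulrDl exprS mulrA ler_pM2r ?exprn_gt0 ?(lt_trans ltr01) //.
have -> : (enorm2 x + C / (t - 1)) * t = enorm2 x + C / (t - 1) + C + enorm2 x * (t - 1).
  by field; rewrite gt_eqF.
by rewrite lerDl mulr_ge0 ?enorm2_ge0 // ltW.
Qed.

Lemma power_growth (t : R) x : 1 < t -> (forall z, eigenvalue A z -> cmod z <= 1) ->
  exists C, forall N, enorm2 (A ^+ N *m x) <= C * t ^+ N.
Proof.
move=> t1 hA; have [s hs] := closed_field_poly_normal (char_poly A).
rewrite (monicP (char_poly_monic _)) scale1r in hs.
apply: (annihilated_power_growth (s := s)) => // [z zs|].
  by apply: hA; rewrite eigenvalue_root_char hs root_prod_XsubC.
by rewrite -hs (Cayley_Hamilton A) mul0mx.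
Qed.

Lemma scaled_powers_vanish (r : R) x e k : 1 < r ->
  (forall z, eigenvalue A z -> cmod z <= 1) -> 0 < e ->
  exists2 N, (k < N)%N & enorm2 ((r^-1%:C%C *: A) ^+ N.*2 *m x) <= e.
Proof.
(* Any [t] strictly between 1 and [r] would do: the powers of [A] grow at most like [t ^+ N], and
   [t / r < 1]. *)
move=> r1 hA e0; pose t := (1 + r) / 2.
have [C hC] := power_growth x (ltac:(rewrite /t; lra) : 1 < t) hA.
have r0 : 0 < r by lra.
have C0 : 0 <= C.
  by have := hC 0%N; rewrite !expr0 mulr1; apply: le_trans; apply: enorm2_ge0.
have q1 : `|t / r| < 1.
  by rewrite ger0_norm ?divr_ge0 ?ltr_pdivrMr ?mul1r /t //; lra.
have e'0 : 0 < e / (C + 1) by rewrite divr_gt0 // ltr_wpDl.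
have /cvgrPdist_lt/(_ _ e'0)[N0 _ hN0] := cvg_expr q1.
exists (maxn k N0).+1; first by rewrite ltnS leq_maxl.
set N := _.*2; have /hN0 : (N0 <= N)%N by rewrite /N; lia.
rewrite /= sub0r normrN => hN.
rewrite exprZn -scalemxAl enorm2Z cmodX cmod_real ?invr_ge0 ?(ltW r0) //.
apply: (@le_trans _ _ (C * (t / r) ^+ N)).
  by rewrite exprMn mulrA mulrC ler_wpM2r ?exprn_ge0 ?invr_ge0 ?(ltW r0).
apply: (@le_trans _ _ (C * (e / (C + 1)))).
  by rewrite ler_wpM2l // ltW // (le_lt_trans (ler_norm _)).
by rewrite mulrCA ler_piMr ?(ltW e0) // ler_pdivrMr ?ltr_wpDl // mul1r lerDl.
Qed.

End Growth.
(** Passage to the limit in [N]. As [f], [b] and [X] are independent of [N], one good [N] for each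
    tolerance is enough; dividing by [b + 1] covers [b = 0]. *)
Lemma le_of_vanishing (R : realType) (f b X : R) (w : nat -> R) k : 0 <= b ->
  (forall e, 0 < e -> exists2 N, (k < N)%N & w N <= e) ->
  (forall N, (k < N)%N -> f <= b * (X + w N)) -> f <= b * X.
Proof.
move=> b0 hw hf; apply/ler_addgt0Pr => e e0.
have [|N kN wN] := hw (e / (b + 1)); first by rewrite divr_gt0 // ltr_wpDl.
apply: le_trans (hf N kN) _; rewrite mulrDr lerD2l.
apply: le_trans (ler_wpM2l b0 wN) _.
by rewrite mulrCA ler_piMr ?(ltW e0) // ler_pdivrMr ?ltr_wpDl // mul1r lerDl.
Qed.

(** * Polarization *)

Section Hermitian.
Variable C : numClosedFieldType.

(** Polarization gives four times the left side as the difference of the quadratic form at [x + y]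
    and [x - y]; the parallelogram law adds up the two bounds. *)
Lemma Re_sesq_le_of_diag n (H : 'M[C]_n) w : H^t* = H ->
  (forall x, `|'Re (sesq x H x)| <= w * sqn x) ->
  forall x y, 'Re (sesq y H x) <= w * ((sqn x + sqn y) / 2).
Proof.
move=> Hh hw x y.
have sDl (u v : 'cV[C]_n) (G : 'M[C]_n) z : sesq (u + v) G z = sesq u G z + sesq v G z.
  by rewrite /sesq trmxCD !mulmxDl mxE.
have sDr (u v : 'cV[C]_n) (G : 'M[C]_n) z : sesq z G (u + v) = sesq z G u + sesq z G v.
  by rewrite /sesq mulmxDr mxE.
have sNl (u : 'cV[C]_n) (G : 'M[C]_n) z : sesq (- u) G z = - sesq u G z.
  by rewrite /sesq -[- u]sub0r trmxCB trmx0 map_mx0 sub0r !mulNmx mxE.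
have sNr (u : 'cV[C]_n) (G : 'M[C]_n) z : sesq z G (- u) = - sesq z G u.
  by rewrite /sesq mulmxN mxE.
have sym : 'Re (sesq x H y) = 'Re (sesq y H x).
  suff -> : sesq y H x = (sesq x H y)^* by rewrite Re_conj.
  have -> : (sesq x H y)^* = ((x^t* *m H *m y)^t*) 0 0 by rewrite /sesq !mxE.
  by rewrite !trmxCM Hh trmxCK mulmxA.
have hplus : 'Re (sesq (x + y) H (x + y)) <= w * sqn (x + y).
  by apply: le_trans (hw _); rewrite real_ler_norm ?Creal_Re.
have hminus : - 'Re (sesq (x - y) H (x - y)) <= w * sqn (x - y).
  by apply: le_trans (hw _); rewrite -normrN real_ler_norm // rpredN Creal_Re.
have par : sqn (x + y) + sqn (x - y) = 2 * (sqn x + sqn y).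
  by rewrite -!sesq1 !sDl !sDr !sNl !sNr; ring.
have := lerD hplus hminus; rewrite -mulrDr par.
have -> : 'Re (sesq (x + y) H (x + y)) - 'Re (sesq (x - y) H (x - y)) =
   4 * 'Re (sesq y H x).
  have ReD (a b : C) : 'Re (a + b) = 'Re a + 'Re b by exact: raddfD.
  have ReN (a : C) : 'Re (- a) = - 'Re a by exact: raddfN.
  by rewrite !sDl !sDr !sNl !sNr !ReD !ReN sym; ring.
move=> le4; rewrite -(ler_pM2l (x := 4)) ?ltr0n //; apply: le_trans le4 _.
by rewrite le_eqVlt; apply/orP; left; apply/eqP; field.
Qed.

End Hermitian.

Lemma natrM_complex (R : realType) (k : nat) (a : R) :
  (k%:R * a)%:C%C = k%:R * a%:C%C.
Proof. by rewrite rmorphM /= rmorph_nat. Qed.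

Lemma conj_real_complex (R : realType) (a : R) : (a%:C%C)^* = a%:C%C :> R[i].
Proof. exact: conjc_real. Qed.

(** * Bounds for the powers of [B] from the resolvent on one circle *)

Section Resolvent.
Variables (R : realType) (n : nat) (A : 'M[R[i]]_n.+1) (r M0 : R).
Hypothesis r1 : 1 < r.
Hypothesis hA : forall z : R[i], eigenvalue A z -> cmod z <= 1.
Hypothesis hM0 : forall z, cmod z = r -> specnorm (invmx (z%:M - A)) <= M0.

Local Notation B := (r^-1%:C%C *: A).

Let r0 : 0 < r. Proof. exact: lt_trans r1. Qed.

Let rM0 : 0 <= r * M0.
Proof.
rewrite mulr_ge0 ?(ltW r0) // (le_trans _ (hM0 (z := r%:C%C) _)) ?specnorm_ge0 //.
by rewrite cmod_real ?(ltW r0).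
Qed.

Lemma resolvent_unit z : cmod z = r -> z%:M - A \in unitmx.
Proof.
move=> zr; have : ~~ eigenvalue A z.
  by apply/negP => /hA; rewrite zr leNgt r1.
rewrite /eigenvalue /eigenspace negbK kermx_eq0 row_free_unit => uA.
by rewrite -opprB -scaleN1r unitmxZ // unitrN1.
Qed.

(** The symbol is [y^*] applied to [(z - B)^-1 (x - B^N x)]. Since [z - B = (r z - A) / r], that
    resolvent has norm at most [r * M0]; the term in [B ^+ N] is the cost of truncation and vanishes
    in the limit. *)
Lemma symbol_le N x y z : (0 < N)%N -> z ^+ N = 1 ->
  `|\sum_(l < N) z ^+ (N - l.+1) * sesq y (B ^+ l) x| <=
  (enorm2 y * (r * M0) * (enorm2 x + enorm2 (B ^+ N *m x)))%:C%C.
Proof.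
move=> N0 zN.
have z1 : cmod (r%:C%C * z) = r.
  rewrite cmodM cmod_real ?(ltW r0) // -[RHS]mulr1; congr (_ * _).
  by apply: complexI; rewrite -normCE (norm_unity_root N0 zN).
have rr : r%:C%C != 0 :> R[i] by apply/eqP => /(@complexI R r 0) r00; move: r0; rewrite r00 ltxx.
have zB : z%:M - B = r%:C%C^-1 *: ((r%:C%C * z)%:M - A).
  have rV : r%:C%C^-1 = r^-1%:C%C :> R[i] by exact/esym/fmorphV.
  by rewrite scalerBr rV scale_scalar_mx mulrA -rV mulVf // mul1r rV.
have uB : z%:M - B \in unitmx.
  by rewrite zB unitmxZ ?resolvent_unit // unitfE invr_eq0.
have -> : \sum_(l < N) z ^+ (N - l.+1) * sesq y (B ^+ l) x =
    sesq y 1%:M (r%:C%C *: (invmx ((r%:C%C * z)%:M - A) *m (x - B ^+ N *m x))).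
  transitivity (sesq y (\sum_(l < N) z ^+ (N - l.+1) *: B ^+ l) x).
    by rewrite sesq_sum; apply: eq_bigr => l _; rewrite sesqZ.
  rewrite resolvent_geom // zB invmxZ -?zB // invrK.
  by rewrite /sesq mulmx1 -!mulmxA -scalemxAl mulmxBl mul1mx.
rewrite normCE lecR; apply: le_trans (cmod_sesq1_le _ _) _.
rewrite enorm2Z cmod_real ?(ltW r0) // -!mulrA ler_wpM2l ?enorm2_ge0 //.
rewrite ler_wpM2l ?(ltW r0) //; apply: le_trans (enorm2_mulmx_le _ _) _.
rewrite ler_pM ?specnorm_ge0 ?enorm2_ge0 ?hM0 //.
by apply: le_trans (enorm2D _ _) _; rewrite enorm2N.
Qed.

Definition scaled_power_bounded k (v : nat) := forall x,
  k.+1%:R * enorm2 (B ^+ k *m x) <= v%:R * (r * M0) * enorm2 x.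

(** Taking [y = B^k x] makes the form equal to [enorm2 y ^+ 2]; after the limit in [N] one factor
    [enorm2 y] cancels. *)
Lemma scaled_power_bounded_sesq k v :
  (forall x y N, (k < N)%N -> k.+1%:R * cmod (sesq y (B ^+ k) x) <=
     v%:R * (enorm2 y * (r * M0) * (enorm2 x + enorm2 (B ^+ N.*2 *m x)))) ->
  scaled_power_bounded k v.
Proof.
move=> hc x; set y := B ^+ k *m x.
have : k.+1%:R * cmod (sesq y (B ^+ k) x) <= v%:R * (enorm2 y * (r * M0)) * enorm2 x.
  apply: (@le_of_vanishing _ _ _ _ (fun N => enorm2 (B ^+ N.*2 *m x)) k) => [|e e0|N kN].
  - by rewrite mulr_ge0 // mulr_ge0 ?enorm2_ge0.
  - exact: scaled_powers_vanish.
  by rewrite -[X in _ <= X]mulrA; apply: hc.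
have -> : sesq y (B ^+ k) x = sqn y.
  by rewrite -sesq1 /sesq mulmx1 -mulmxA.
rewrite sqnE cmod_real ?sqr_ge0 //.
have [->|y0] := eqVneq (enorm2 y) 0.
  by move=> _; rewrite mulr0 !mulr_ge0 ?enorm2_ge0 ?(ltW r0) //; move: rM0; rewrite pmulr_rge0.
have yp : 0 < enorm2 y by rewrite lt_def y0 enorm2_ge0.
by move=> h; rewrite -(ler_pM2l yp); apply: le_trans (le_trans _ h) _;
  rewrite le_eqVlt; apply/orP; left; apply/eqP; ring.
Qed.

(** Here [k.+1] stands on both sides and cancels, so a bound on a single Hankel coefficient
    suffices. *)
Lemma scaled_power_bounded_succ k : scaled_power_bounded k k.+1.
Proof.
apply: scaled_power_bounded_sesq => x y N kN; rewrite ler_wpM2l // -lecR -normCE.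
apply: (hankel_coef_le (c := fun l => sesq y (B ^+ l) x) kN) => z zN; by apply: symbol_le => //; lia.
Qed.

Lemma scaled_power_bounded_mxminpoly k : scaled_power_bounded k (degree_mxminpoly A).
Proof.
set d := degree_mxminpoly A.
apply: scaled_power_bounded_sesq => x y N kN.
set M := enorm2 y * _ * _.
have M_ge0 : 0 <= M by rewrite mulr_ge0 ?addr_ge0 ?enorm2_ge0 // mulr_ge0 ?enorm2_ge0.
(* Coordinates of [A ^+ l] over the powers of [A] below the degree of its minimal polynomial, with
   the scaling of [B] absorbed. *)
pose h l (t : 'I_d) := r^-1%:C%C ^+ l * (mxvec (A ^+ l) *m pinvmx (powers_mx A d)) 0 t.
have hW l : B ^+ l = \sum_t h l t *: A ^+ t.
  have := horner_mx_mem A 'X^l; rewrite rmorphXn /= horner_mx_X => /mulmxKpV Al.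
  rewrite exprZn -[in LHS](mxvecK (A ^+ l)) -Al mulmx_sum_row linear_sum scaler_sumr.
  by apply: eq_bigr => t _; rewrite linearZ /= rowK mxvecK scalerA.
rewrite -lecR !natrM_complex -normCE.
have hM z : z ^+ N.*2 = 1 ->
    `|\sum_(l < N.*2) z ^+ (N.*2 - l.+1) * sesq y (B ^+ l) x| <= M%:C%C.
  by move=> zN; apply: symbol_le => //; lia.
apply: le_trans (hankel_rank_le (c := fun l => sesq y (B ^+ l) x) kN hM) _.
by rewrite ler_wpM2r ?lecR // ?ler0c // ler_nat; exact: rank_hankel_powers_le hW.
Qed.

Section Selfadjoint.
Variable J : 'M[R[i]]_n.+1.
Hypotheses (Jherm : J^t* = J) (JJ : J *m J = 1%:M) (hAJ : A^t* *m J = J *m A).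

Let BJ l : (B ^+ l)^t* *m J = J *m B ^+ l.
Proof.
elim: l => [|l IH]; first by rewrite expr0 trmxC1 mul1mx mulmx1.
rewrite exprS trmxCM -mulmxA.
have -> : B^t* *m J = J *m B.
  by rewrite trmxCZ conj_real_complex -scalemxAl hAJ scalemxAr.
by rewrite mulmxA IH -mulmxA mulmxE -exprSr exprS.
Qed.

Lemma enorm2_unitary x : enorm2 (J *m x) = enorm2 x.
Proof.
have : sqn (J *m x) = sqn x by rewrite -sesq1 sesq_mul mulmx1 Jherm JJ sesq1.
by rewrite !sqnE => /complexI/eqP; rewrite eqrXn2 ?enorm2_ge0 // => /eqP.
Qed.

(** Selfadjointness turns the coefficients [x^* J B^(i+l) x] into the Gram matrix, for the form [J],
    of the orbit [B^l x]. *)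
Lemma Re_sesq_selfadjoint_le k N x : (k < N)%N ->
  k.+1%:R * `|'Re (sesq x (J *m B ^+ k) x)| <=
  ((2 * \rank (1%:M - J)%R + 1)%:R * (enorm2 x * (r * M0) * (enorm2 x + enorm2 (B ^+ N.*2 *m x))))%:C%C.
Proof.
move=> kN; set M := enorm2 x * _ * _.
have M_ge0 : 0 <= M by rewrite mulr_ge0 ?addr_ge0 ?enorm2_ge0 // mulr_ge0 ?enorm2_ge0.
pose c l := sesq x (J *m B ^+ l) x.
pose V : 'M[R[i]]_(n.+1, N) := \matrix_(i, l) (B ^+ l *m x) i 0.
have colV l : col l V = B ^+ l *m x by apply/colP => i; rewrite !mxE.
have hV : hankel N c = V^t* *m J *m V.
  apply/matrixP => i j; rewrite -sesq_col !colV sesq_mul BJ mxE.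
  by rewrite /c exprD mulmxA.
(* Here [J] fixes [V *m u], so the form is the squared norm of [V *m u]. *)
have hpos u : ((1%:M - J) *m V) *m u = 0 -> 0 <= 'Re (sesq u (hankel N c) u).
  rewrite -mulmxA mulmxBl mul1mx => /subr0_eq VJ.
  rewrite hV -sesq_mul -[J]mulmx1 /sesq -!mulmxA mul1mx -VJ.
  have := sesq1 (V *m u); rewrite /sesq mulmx1 => ->.
  by rewrite (Creal_ReP _ _) ?sqn_ge0 ?ger0_real ?sqn_ge0.
have hM z : z ^+ N.*2 = 1 -> `|\sum_(l < N.*2) z ^+ (N.*2 - l.+1) * c l| <= M%:C%C.
  move=> zN; rewrite /M -{1}(enorm2_unitary x).
  apply: le_trans (symbol_le x (J *m x) _ zN); last by lia.
  rewrite le_eqVlt; apply/orP; left; apply/eqP; congr `|_|; apply: eq_bigr => l _.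
  by rewrite /c /sesq trmxCM Jherm !mulmxA.
apply: le_trans (hankel_inertia_le kN hM hpos) _.
rewrite natrM_complex ler_wpM2r ?ler0c // ler_nat.
by rewrite leq_add2r leq_mul2l mxrankM_maxl.
Qed.

(** The previous bound concerns only the quadratic form of [J B^k]; that matrix is Hermitian, so
    polarization recovers its norm, and [J] preserves the Euclidean norm. *)
Lemma scaled_power_bounded_selfadjoint k :
  scaled_power_bounded k (2 * \rank (1%:M - J)%R + 1).
Proof.
set v := (2 * _ + 1)%N; pose w := (v%:R * (r * M0)) / k.+1%:R.
have w0 : 0 <= w by rewrite divr_ge0 // mulr_ge0.
pose H := J *m B ^+ k.
have Hh : H^t* = H by rewrite trmxCM Jherm BJ.
have hw x : `|'Re (sesq x H x)| <= w%:C%C * sqn x.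
  have : k.+1%:R * cmod ('Re (sesq x H x)) <= v%:R * (enorm2 x * (r * M0)) * enorm2 x.
    apply: (@le_of_vanishing _ _ _ _ (fun N => enorm2 (B ^+ N.*2 *m x)) k) => [|e e0|N kN].
    - by rewrite mulr_ge0 // mulr_ge0 ?enorm2_ge0.
    - exact: scaled_powers_vanish.
    rewrite -lecR natrM_complex -normCE -[X in _ <= X%:C%C]mulrA.
    exact: Re_sesq_selfadjoint_le.
  rewrite sqnE normCE -rmorphM lecR /w => hx.
  rewrite mulrAC ler_pdivlMr ?ltr0n // mulrC; apply: le_trans hx _.
  by rewrite le_eqVlt; apply/orP; left; apply/eqP; ring.
move=> x; have [x0|x0] := eqVneq (enorm2 x) 0.
  by rewrite (enorm2_eq0 x0) mulmx0 !enorm2_0 !mulr0.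
have xp : 0 < enorm2 x by rewrite lt_def x0 enorm2_ge0.
rewrite mulrC -ler_pdivlMr ?ltr0n // mulrAC -/w.
rewrite -enorm2_unitary mulmxA -/H; set t := enorm2 (H *m x).
have [->|t0] := eqVneq t 0; first by rewrite mulr_ge0 ?enorm2_ge0.
have tp : 0 < t by rewrite lt_def t0 enorm2_ge0.
(* Rescales [H *m x] to the length of [x], so that the mean of squares in the polarized bound is
   just [enorm2 x ^+ 2]. *)
pose a := enorm2 x / t.
have a0 : 0 <= a by rewrite divr_ge0 ?enorm2_ge0.
have := Re_sesq_le_of_diag Hh hw x (a%:C%C *: (H *m x)).
have -> : sesq (a%:C%C *: (H *m x)) H x = (enorm2 x * t)%:C%C.
  have -> : sesq (a%:C%C *: (H *m x)) H x = a%:C%C * sqn (H *m x).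
    rewrite -sesq1 /sesq trmxCZ conj_real_complex mulmx1 -!scalemxAl mxE.
    by rewrite -[in LHS]mulmxA.
  by rewrite sqnE -/t -rmorphM /=; congr (_%:C%C); rewrite /a; field.
rewrite -complexRe /= !sqnE enorm2Z cmod_real // -/t.
have -> : a * t = enorm2 x by rewrite /a; field.
rewrite -rmorphD /=.
have -> : 2 = (2%:R : R)%:C%C :> R[i] by rewrite rmorph_nat.
rewrite -fmorphV -!rmorphM /= lecR => h.
rewrite -(ler_pM2l xp); apply: le_trans h _.
by rewrite le_eqVlt; apply/orP; left; apply/eqP; field.
Qed.

End Selfadjoint.
End Resolvent.

(** * Assembling the bounds for the powers of [A] *)

Section PowerBounds.
Variables (R : realType) (n : nat) (A : 'M[R[i]]_n.+1).

Lemma scaled_power_boundedW r M0 k v w : 0 <= r * M0 -> (v <= w)%N ->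
  scaled_power_bounded A r M0 k v -> scaled_power_bounded A r M0 k w.
Proof.
move=> rM0 vw hv x; apply: le_trans (hv x) _.
by rewrite ler_wpM2r ?enorm2_ge0 // ler_wpM2r // ler_nat.
Qed.

Lemma scaled_power_bounded_minn r M0 k v w :
  scaled_power_bounded A r M0 k v -> scaled_power_bounded A r M0 k w ->
  scaled_power_bounded A r M0 k (minn v w).
Proof. by move=> hv hw; rewrite /minn; case: ifP. Qed.

Lemma specnorm_power_le r M0 k v : 1 < r -> 0 <= M0 ->
  scaled_power_bounded A r M0 k v ->
  specnorm (A ^+ k) <= r ^+ k.+1 / k.+1%:R * v%:R * M0.
Proof.
move=> r1 M00 hv; have r0 : 0 < r := lt_trans ltr01 r1.
apply: specnorm_le => x x1.
have -> : A ^+ k *m x = r%:C%C ^+ k *: ((r^-1%:C%C *: A) ^+ k *m x).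
  rewrite exprZn -scalemxAl scalerA -exprMn.
  have -> : r%:C%C * r^-1%:C%C = 1 :> R[i].
    by rewrite -[LHS](rmorphM (real_complex R)) /= mulfV ?gt_eqF.
  by rewrite expr1n scale1r.
rewrite enorm2Z cmodX cmod_real ?(ltW r0) //.
have -> : r ^+ k.+1 / k.+1%:R * v%:R * M0 = r ^+ k * (v%:R * (r * M0) / k.+1%:R).
  by rewrite exprS; ring.
rewrite ler_pM2l ?exprn_gt0 // ler_pdivlMr ?ltr0n // mulrC.
by apply: le_trans (hv x) _; rewrite ler_piMr // !mulr_ge0 ?(ltW r0).
Qed.

(** The radius stays free, as [k >= 1] and [k = 0] call for different choices. *)
Lemma kreiss_power_le (J : 'M[R[i]]_n.+1) (q : nat) (K r : R) (k : nat) :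
  J^t* = J -> J *m J = 1%:M -> inertia J = (n.+1 - q, q)%N -> A^t* *m J = J *m A ->
  (forall z, eigenvalue A z -> cmod z <= 1) ->
  (forall z, 1 < cmod z -> (cmod z - 1) * specnorm (invmx (z%:M - A)) <= K) ->
  1 < r ->
  specnorm (A ^+ k) <=
    r ^+ k.+1 / k.+1%:R / (r - 1) * (minn k.+1 (nuJ J A))%:R * K.
Proof.
move=> Jh JJ [hp hq] hAJ hA hK r1; have r0 : 0 < r := lt_trans ltr01 r1.
have r10 : 0 < r - 1 by rewrite subr_gt0.
pose M0 := K / (r - 1).
have hM0 z : cmod z = r -> specnorm (invmx (z%:M - A)) <= M0.
  move=> zr; rewrite ler_pdivlMr // mulrC -[in X in X - 1]zr.
  by apply: hK; rewrite zr.
have M00 : 0 <= M0.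
  apply: le_trans (hM0 r%:C%C _); first exact: specnorm_ge0.
  by rewrite cmod_real // ltW.
have rM0 : 0 <= r * M0 by rewrite mulr_ge0 // ltW.
have -> : r ^+ k.+1 / k.+1%:R / (r - 1) * (minn k.+1 (nuJ J A))%:R * K =
    r ^+ k.+1 / k.+1%:R * (minn k.+1 (nuJ J A))%:R * M0 by rewrite /M0; ring.
apply: specnorm_power_le => //.
have [rkN rkP] := involution_rank_le Jh JJ.
apply: scaled_power_bounded_minn; first exact: scaled_power_bounded_succ.
apply: scaled_power_bounded_minn; first exact: scaled_power_bounded_mxminpoly.
apply: scaled_power_bounded_minn.
  apply: scaled_power_boundedW (scaled_power_bounded_selfadjoint r1 hA hM0 Jh JJ hAJ k) => //.
  by rewrite leq_add2r leq_mul2l.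
(* [A] is also selfadjoint for [- J], whose rank [1 - (- J)] counts the positive eigenvalues of
   [J]. *)
have NJh : (- J)^t* = - J by rewrite -sub0r trmxCB trmx0 map_mx0 Jh.
have NJJ : - J *m - J = 1%:M by rewrite mulNmx mulmxN opprK.
have hANJ : A^t* *m - J = - J *m A by rewrite mulmxN mulNmx hAJ.
apply: scaled_power_boundedW (scaled_power_bounded_selfadjoint r1 hA hM0 NJh NJJ hANJ k) => //.
by rewrite opprK leq_add2r leq_mul2l -[X in (_ <= _ - X)%N]/(inertia J).2 /= hq -hp.
Qed.

End PowerBounds.

Local Open Scope complex_scope.

Theorem corollary4p4 (R : realType) (n q : nat) (J A : 'M[R[i]]_n.+1)
    (hJherm : J^t* = J) (hJinv : J *m J = 1%:M)
    (hJinertia : inertia J = (n.+1 - q, q)%N)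
    (hAJ : A^t* *m J = J *m A)
    (hspec : forall z : R[i], eigenvalue A z -> cmod z <= 1) :
  (forall k : nat, (1 <= k)%N ->
     ((specnorm (A ^+ k))%:E <=
      ((1 + k%:R^-1) ^+ k * (minn k.+1 (nuJ J A))%:R)%:E * kreiss A)%E) /\
  (forall k : nat,
     ((specnorm (A ^+ k))%:E <=
      (expR 1 * (minn k.+1 (nuJ J A))%:R)%:E * kreiss A)%E).
Proof.
(* Strict positivity matters when the Kreiss constant is infinite: zero times infinity would be
   zero. *)
have v_gt0 k : 0 < (minn k.+1 (nuJ J A))%:R :> R.
  rewrite ltr0n leq_min /= /nuJ !leq_min mxminpoly_nonconstant; lia.
have kreiss_ge z : 1 < cmod z ->
    (((cmod z - 1) * specnorm (invmx (z%:M - A)))%:E <= kreiss A)%E.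
  by move=> z1; apply: ereal_sup_ubound; exists z.
(* A sample point outside the disk: it gives [0 <= K] and excludes the value minus infinity. *)
have cmod2 : 1 < cmod (2%:R%:C : R[i]) by rewrite cmod_real ?ltr1n.
move: kreiss_ge; case: (kreiss A) => [K| |] hK.
- have bound r k := @kreiss_power_le R n A J q K r k hJherm hJinv hJinertia hAJ hspec hK.
  have K0 : 0 <= K.
    rewrite -lee_fin; apply: le_trans (hK _ cmod2); rewrite lee_fin.
    by rewrite mulr_ge0 ?specnorm_ge0 // subr_ge0 ltW.
  have main k : (1 <= k)%N ->
      specnorm (A ^+ k) <= (1 + k%:R^-1) ^+ k * (minn k.+1 (nuJ J A))%:R * K.
    move=> k1; have k0 : 0 < k%:R :> R by rewrite ltr0n.
    (* This radius minimizes [r^(k+1) / (r - 1)], and the factor collapses to [(1 + 1/k)^k]. *)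
    have := bound (1 + k%:R^-1) k; rewrite ltrDl invr_gt0 => /(_ k0).
    suff -> : (1 + k%:R^-1) ^+ k.+1 / k.+1%:R / (1 + k%:R^-1 - 1) = (1 + k%:R^-1) ^+ k :> R by [].
    have cancel (p x : R) : 0 < x -> p * (1 + x^-1) / (x + 1) / (1 + x^-1 - 1) = p.
      move=> x0; rewrite addrAC subrr add0r invrK.
      by field; rewrite !gt_eqF ?addr_gt0.
    by rewrite exprSr -natr1 cancel.
  split=> k; first by rewrite -EFinM lee_fin; apply: main.
  rewrite -EFinM lee_fin; case: k => [|k].
    (* For [k = 0] the radius 2 gives the factor 2, and [1 + 1 <= e]. *)
    apply: le_trans (bound 2 0%N _) _; first by rewrite ltr1n.
    rewrite ler_wpM2r // ler_wpM2r ?ler0n //.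
    apply: le_trans (expR_ge1Dx 1); by rewrite (_ : 2 - 1 = 1 :> R) ?expr1 ?divr1 //; ring.
  apply: le_trans (main k.+1 isT) _.
  rewrite ler_wpM2r // ler_wpM2r ?ler0n //.
  have -> : expR 1 = expR (k.+1%:R^-1) ^+ k.+1 :> R.
    by rewrite -expRM_natl mulfV ?pnatr_eq0.
  by rewrite lerXn2r ?nnegrE ?expR_ge0 ?addr_ge0 ?invr_ge0 ?expR_ge1Dx.
- split=> k; first move=> k1.
    by rewrite gt0_muley ?leey // lte_fin mulr_gt0 // exprn_gt0 // ltr_pwDl ?invr_ge0.
  by rewrite gt0_muley ?leey // lte_fin mulr_gt0 // expR_gt0.
- by have := hK _ cmod2.
Qed.
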